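(* The configuration-LP for the Restricted Assignment problem has an integrality gap of at most $2 - 1/6 = 11/6$. That is, for every instance of Restricted Assignment, if $\mathrm{OPT}$ denotes the minimum makespan of a schedule and $\mathrm{OPT}^*$ denotes the minimum $T$ for which the configuration-LP with target makespan $T$ is feasible, then $\mathrm{OPT} \le (2 - 1/6)\,\mathrm{OPT}^*$.
   Context: An instance of Restricted Assignment consists of a finite set of jobs $\mathcal J$ and a finite set of machines $\mathcal M$; each job $j$ has a processing time $p_j \ge 0$ and a nonempty set $\Gamma(j)\subseteq\mathcal M$ of machines on which it is allowed, so that $p_{ij}=p_j$ if $i\in\Gamma(j)$ and $p_{ij}=\infty$ otherwise. A schedule is a function $\sigma:\mathcal J\to\mathcal M$ with $\sigma(j)\in\Gamma(j)$ for all $j$; its makespan is $\max_{i\in\mathcal M}\sum_{j\in\sigma^{-1}(i)} p_{ij}$, and $\mathrm{OPT}$ is the minimum makespan over all schedules. For a target makespan $T$ and machine $i$, the set of configurations is $\mathcal C_i(T)=\{C\subseteq\mathcal J : \sum_{j\in C}p_{ij}\le T\}$. The configuration-LP for $T$ is the feasibility problem in variables $x_{i,C}\ge 0$ ($i\in\mathcal M$, $C\in\mathcal C_i(T)$): $\sum_{C\in\mathcal C_i(T)}x_{i,C}\le 1$ for all $i\in\mathcal M$, and $\sum_{i\in\mathcal M}\sum_{C\in\mathcal C_i(T):\, j\in C}x_{i,C}\ge 1$ for all $j\in\mathcal J$. $\mathrm{OPT}^*$ is the minimal $T$ for which this LP is feasible. The integrality gap is the supremum over instances of $\mathrm{OPT}/\mathrm{OPT}^*$.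 *)

(* Defs.v *)
From HB Require Import structures.
From mathcomp Require Import all_boot all_order all_algebra.
From mathcomp Require Import all_classical all_reals.

Set Implicit Arguments.
Unset Strict Implicit.
Unset Printing Implicit Defensive.

Import Order.TTheory GRing.Theory Num.Theory.

Local Open Scope classical_set_scope.
Local Open Scope ring_scope.

Record ra_instance (R : realType) := RAInstance {
  job : finType;
  machine : finType;
  ptime : job -> R;
  allowed : job -> {set machine};
  ptime_ge0 : forall j, 0 <= ptime j;
  allowed_neq0 : forall j, allowed j != finset.set0 }.

Definition minimum_of d (T : porderType d) (A : set T) (x : T) : Prop :=
  A x /\ lbound A x.

Section RestrictedAssignment.
Variables (R : realType) (I : ra_instance R).
Local Notation J := (job I).
Local Notation M := (machine I).

Definition mptime (i : M) (j : J) : \bar R :=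
  if i \in allowed j then (ptime j)%:E else +oo%E.

Definition schedule (s : {ffun J -> M}) : bool :=
  [forall j, s j \in allowed j].

(* The default value 0 is harmless because loads are nonnegative; it is the
   makespan when there are no machines (and hence no jobs). *)
Definition makespan (s : {ffun J -> M}) : \bar R :=
  \big[maxe/0%E]_(i : M) (\sum_(j | s j == i) mptime i j)%E.

Definition is_OPT (v : R) : Prop :=
  minimum_of [set makespan s | s in [set s | schedule s]] v%:E.

Definition configs (T : R) (i : M) : {set {set J}} :=
  finset (fun C : {set J} => (\sum_(j in C) mptime i j <= T%:E)%E).

(* Only the values x i C with C \in configs T i are LP variables. *)
Definition config_LP (T : R) (x : M -> {set J} -> R) : Prop :=
  [/\ forall i C, C \in configs T i -> 0 <= x i C,
      forall i, \sum_(C in configs T i) x i C <= 1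
    & forall j, 1 <= \sum_(i : M) \sum_(C in configs T i | j \in C) x i C].

Definition config_LP_feasible (T : R) : Prop := exists x, config_LP T x.

(* Target makespans are nonnegative.  This matters only for instances without
   jobs, whose LP is also feasible for every negative T; otherwise
   configs T i is empty for T < 0. *)
Definition is_OPTstar (T : R) : Prop :=
  minimum_of [set T' | 0 <= T' /\ config_LP_feasible T'] T.

Lemma mptime_ge0 i j : (0 <= mptime i j)%E.
Proof. by rewrite /mptime; case: ifP => _; rewrite ?leey ?lee_fin ?ptime_ge0. Qed.

Lemma in_configs T i (C : {set J}) :
  (C \in configs T i) =
  [forall j in C, i \in allowed j] && (\sum_(j in C) ptime j <= T).
Proof.
rewrite finset.inE; case: (boolP [forall j in C, _]) => [/forall_inP iC|] /=.
  have -> : (\sum_(j in C) mptime i j = (\sum_(j in C) ptime j)%:E)%E.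
    by rewrite -sumEFin; apply: eq_bigr => j /iC ij; rewrite /mptime ij.
  by rewrite lee_fin.
rewrite negb_forall_in => /exists_inP[j jC /negbTE ij]; apply/negbTE.
rewrite -ltNge (bigD1 j)//= {1}/mptime ij addye ?ltry//.
rewrite gt_eqF// (@lt_le_trans _ _ 0%E) ?ltNy0//.
by apply: sume_ge0 => k _; exact: mptime_ge0.
Qed.

Lemma load_schedule s i : schedule s ->
  (\sum_(j | s j == i) mptime i j = (\sum_(j | s j == i) ptime j)%:E)%E.
Proof.
move=> /forallP sP; rewrite -sumEFin; apply: eq_bigr => j /eqP <-.
by rewrite /mptime sP.
Qed.

Lemma makespan_schedule s : schedule s ->
  makespan s = (\big[Num.max/0]_i \sum_(j | s j == i) ptime j)%:E.
Proof.
move=> sP; rewrite /makespan (eq_bigr _ (fun i _ => load_schedule i sP)).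
by apply/esym; apply: (big_morph (@EFin R)) => // x y; rewrite EFin_max.
Qed.

Lemma is_OPT_exists : exists v, is_OPT v.
Proof.
have aP (j : J) : exists i, i \in allowed j.
  by have /set0Pn := allowed_neq0 j.
pose s0 := [ffun j => xchoose (aP j)].
have s0P : schedule s0 by apply/forallP => j; rewrite ffunE (xchooseP (aP j)).
case: (arg_minP makespan s0P) => s sP smin.
exists (\big[Num.max/0]_i \sum_(j | s j == i) ptime j).
rewrite /is_OPT -makespan_schedule//; split; first by exists s.
by move=> _ [s' /= s'P <-]; exact: smin.
Qed.

Lemma is_OPT_feasible v : is_OPT v -> 0 <= v /\ config_LP_feasible v.
Proof.
move=> [[s /= sP sv] _].
have v0 : 0 <= v.
  rewrite -lee_fin -sv /makespan.
  elim/big_ind : _ => //; first by move=> x y x0 y0; rewrite le_max x0.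
  by move=> i _; apply: sume_ge0 => j _; exact: mptime_ge0.
split => //.
pose S i : {set J} := finset (fun j => s j == i).
have SP i : S i \in configs v i.
  rewrite finset.inE -sv /makespan (bigD1 i)//= le_max.
  rewrite (eq_bigl (fun j => s j == i)) ?lexx// => j.
  by rewrite finset.inE.
exists (fun i C => (C == S i)%:R); split.
- by move=> i C _; exact: ler0n.
- move=> i; rewrite (bigD1 (S i))//= eqxx big1 ?addr0// => C /andP[_ /negbTE ->].
  by [].
- move=> j; rewrite (bigD1 (s j))//= (bigD1 (S (s j)))/=; last first.
    by rewrite SP finset.inE eqxx.
  by rewrite eqxx -addrA lerDl addr_ge0 ?sumr_ge0// => i _; rewrite sumr_ge0.
Qed.

Lemma is_OPTstar_exists : exists T, is_OPTstar T.
Proof.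
pose w (C : {set J}) := \sum_(j in C) ptime j.
have w0 C : 0 <= w C by apply: sumr_ge0 => j _; exact: ptime_ge0.
have round T : 0 <= T -> config_LP_feasible T ->
    exists2 C, w C <= T & config_LP_feasible (w C).
  move=> T0 [x xP].
  have P0 : w finset.set0 <= T by rewrite /w big_set0.
  case: (@arg_maxP _ _ _ _ (fun C => w C <= T) w P0) => C CT Cmax.
  exists C => //; exists x.
  suff E i : configs (w C) i = configs T i.
    by case: xP => x0 x1 x2; split => [i D|i|j]; rewrite ?E//; [exact: x0|
      rewrite (le_trans (x2 j))// le_eqVlt; apply/orP; left; apply/eqP;
      apply: eq_bigr => i _; rewrite E].
  apply/setP => D; rewrite !in_configs; congr (_ && _).
  by apply/idP/idP => [/le_trans|/Cmax]//; apply.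
have [v /is_OPT_feasible[v0 vF]] := is_OPT_exists.
have [C0 _ /asboolP C0F] := round v v0 vF.
case: (@arg_minP _ _ _ _ (fun C => `[< config_LP_feasible (w C) >]) w C0F).
move=> C /asboolP CF Cmin; exists (w C); split => // T [T0 /(round T T0)].
by move=> [D DT /asboolP /Cmin /le_trans]; apply.
Qed.

End RestrictedAssignment.

(* Main.v *)
(* The jobs are scheduled one at a time, by local search.  Write t for OPT* and
   call a job big if p > t/2 and huge if p > 5/6 t.  To insert a job j0 one
   grows a list of blockers: a blocker records that a job wants to enter a
   machine i but does not fit, and makes some of the jobs on i active, i.e.
   these now want to move as well.  If all jobs on i become active, then i is
   frozen and no job may enter it.  When an active job can move, the move makes
   progress on the oldest blocker that made the job active, and a lexicographic
   argument shows that this terminates.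

   If the search were stuck, then z_j := min(p_j, 5/6 t) for active j (0 for
   the others), y_i := t for frozen i and y_i := z(jobs on i) otherwise would
   violate weak LP duality: z(C) <= y_i for all configurations C of i, but
   the sum of the z_j exceeds that of the y_i.  For the latter, a machine frozen
   by a small job has z-load at least 7/6 t and one frozen by a big job that is
   not huge at least t, whereas a machine frozen by a huge job may only have
   5/6 t; but the latter happens only if small jobs on it can go elsewhere, so
   it can be paired with a machine that is frozen next by a small job. *)

Require Import Defs.
From mathcomp Require Import all_boot all_order all_algebra.
From mathcomp Require Import lra.
From mathcomp Require boolp.

Set Implicit Arguments.
Unset Strict Implicit.
Unset Printing Implicit Defensive.

Import Order.TTheory GRing.Theory Num.Theory.
Local Open Scope ring_scope.

(** * Partial schedules, blockers and the search state *)

Section LocalSearch.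

Variables (R : realFieldType) (J M : finType) (p : J -> R).
Variables (gam : J -> {set M}) (t : R) (j0 : J).
Hypothesis p_ge0 : forall j, 0 <= p j.
Hypothesis p_le : forall j, p j <= t.

Local Notation cap := (11 / 6 * t).

Implicit Types (s : {ffun J -> option M}) (i : M) (j : J) (K : {set J}).

Definition wt (X : {set J}) := \sum_(j in X) p j.
Definition big j := 1 / 2 * t < p j.
Definition huge j := 5 / 6 * t < p j.

Definition jobs s i := [set j | s j == Some i].
Definition bigs s i := [set j in jobs s i | big j].
Definition fits s j i := wt (jobs s i) + p j <= cap.

Definition feasible (D : {set J}) s :=
  [/\ forall j, (j \in D) = (s j != None),
      forall j i, s j = Some i -> i \in gam j
    & forall i, wt (jobs s i) <= cap].

(* Jobs in [barred] may not enter [target], and those on it are active. *)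
Record blocker :=
  Blocker { mover : J; target : M; barred : {set J}; rank : nat }.
Implicit Types (b : blocker) (tr : seq blocker).

Definition keys tr := [seq (target b, barred b) | b <- tr].

Definition frozen tr := [set i | (i, setT) \in keys tr].

(* Small jobs that can only go to frozen machines: they count as active, but
   they never move while the blockers in [tr] persist. *)
Definition locked tr s i :=
  [set j in jobs s i | ~~ big j & gam j \subset i |: frozen tr].

Definition active tr s j :=
  [|| j == j0, [exists i, j \in locked tr s i]
    | [exists k : M * {set J},
        [&& k \in keys tr, s j == Some k.1 & j \in k.2]]].

Definition potential tr s j i :=
  [/\ active tr s j, i \in gam j, s j != Some i
    & forall K, (i, K) \in keys tr -> j \notin K].

Definition light j := [set k | big k & p k <= p j].

(* In [Blocks_light], [k] is the lightest big job such that the locked jobs and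
   the big jobs up to [k] suffice to keep [j] out.  The job [j] itself is not
   barred, so that [setT] always stands for a frozen machine, even if all jobs
   of the instance are big. *)
Variant blocks tr s j i : {set J} -> Prop :=
| Blocks_all of ~~ fits s j i
    & (big j -> ~~ huge j -> forall k, k \in jobs s i -> ~~ huge k)
    & (huge j -> wt (locked tr s i) + wt (bigs s i) + p j <= cap) :
    blocks tr s j i setT
| Blocks_huge k of big j & ~~ huge j & k \in jobs s i & huge k :
    blocks tr s j i [set k | huge k]
| Blocks_light k of huge j & k \in bigs s i
    & wt (locked tr s i) + p j <= cap
    & cap < wt (locked tr s i) + wt (jobs s i :&: light k) + p j
    & (forall l, l \in bigs s i -> p l < p k ->
        wt (locked tr s i) + wt (jobs s i :&: light l) + p j <= cap) :
    blocks tr s j i (light k :\ j).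

Definition deficient tr :=
  if tr is b :: _ then huge (mover b) && (barred b == setT) else false.

(** The newest blocker comes first, and each is tested against the older ones only, so it survives
    any change to newer ones. The last clause forces a small mover right after a machine frozen for
    a huge job. *)
Fixpoint good tr s : Prop :=
  if tr is b :: tr' then
    [/\ good tr' s, potential tr' s (mover b) (target b),
        blocks tr' s (mover b) (target b) (barred b)
          /\ rank b = #|~: barred b :|: jobs s (target b)|,
        (target b, barred b) \notin keys tr'
      & deficient tr' -> ~~ big (mover b)]
  else True.

Lemma in_jobs s i j : (j \in jobs s i) = (s j == Some i).
Proof. by rewrite inE. Qed.

Lemma t_ge0 : 0 <= t.
Proof. exact: le_trans (p_ge0 j0) (p_le j0). Qed.

Lemma huge_big j : huge j -> big j.
Proof. by rewrite /huge /big => h; have := t_ge0; lra. Qed.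

Lemma wt_ge0 (X : {set J}) : 0 <= wt X.
Proof. exact: sumr_ge0. Qed.

Lemma sum_subset (f : J -> R) (X Y : {set J}) :
  (forall j, 0 <= f j) -> X \subset Y ->
  \sum_(j in X) f j <= \sum_(j in Y) f j.
Proof.
move=> f0 XY; rewrite (big_setID X (A := Y)) /=.
by rewrite (setIidPr XY) lerDl sumr_ge0.
Qed.

Lemma wt_subset (X Y : {set J}) : X \subset Y -> wt X <= wt Y.
Proof. exact: sum_subset. Qed.

(** * Existence and stability of barred sets *)

Lemma exists_blocks tr s j i :
  ~~ fits s j i -> (huge j -> wt (locked tr s i) + p j <= cap) ->
  exists K, blocks tr s j i K.
Proof.
move=> nfit lock_le.
have [hj|nhj] := boolP (huge j); last first.
  have [bj|nbj] := boolP (big j); last first.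
    exists setT; apply: Blocks_all => //; first by move=> b; rewrite b in nbj.
    by move=> h; rewrite h in nhj.
  have [/existsP[k /andP[ki kh]]|nk] :=
      boolP [exists k, (k \in jobs s i) && huge k].
    by exists [set k | huge k]; apply: (Blocks_huge _ bj nhj ki kh).
  exists setT; apply: Blocks_all => //; last by move=> h; rewrite h in nhj.
  move=> _ _ k ki; apply/negP => kh; case/negP: nk.
  by apply/existsP; exists k; rewrite ki.
have [le|gt] := lerP (wt (locked tr s i) + wt (bigs s i) + p j) cap.
  by exists setT; apply: Blocks_all => //; rewrite hj.
have {}lock_le := lock_le hj.
have [k0 k0i] : exists k, k \in bigs s i.
  apply/set0Pn/negP => /eqP E; move: gt.
  by rewrite E /wt big_set0 addr0 ltNge lock_le.
pose P k := (k \in bigs s i) &&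
  (cap < wt (locked tr s i) + wt (jobs s i :&: light k) + p j).
(* All big jobs on [i] lie in [light k1], so [k1] satisfies [P] and a lightest such job exists. *)
have [k1 k1i k1max] := arg_maxP p k0i.
have Pk1 : P k1.
  apply/andP; split=> //; suff -> : jobs s i :&: light k1 = bigs s i by [].
  apply/setP => k; rewrite !inE; case ki: (s k == Some i) => //=.
  case bk: (big k) => //=.
  by have /k1max : k \in bigs s i by rewrite !inE ki bk.
have [k /andP[ki kgt] kmin] := arg_minP p Pk1.
exists (light k :\ j); apply: Blocks_light => // l li lk.
rewrite leNgt; apply/negP => lgt.
have := kmin l; rewrite /P li lgt => /(_ isT).
by rewrite leNgt lk.
Qed.

(* When a job leaves [i], the barred set can only grow: hence the rank of a
   blocker drops when one of its barred jobs leaves. *)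
Lemma blocks_mono tr s s' j i K K' :
  jobs s' i \subset jobs s i -> locked tr s' i \subset locked tr s i ->
  blocks tr s j i K -> blocks tr s' j i K' -> K \subset K'.
Proof.
move=> sub lsub.
have bsub : bigs s' i \subset bigs s i.
  apply/subsetP => k; rewrite ![_ \in bigs _ _]inE => /andP[/(subsetP sub) -> ->].
  by [].
move=> B B'; case: B' => [_ _ _|k' bj nhj ki' kh'|k' hj k'i lk' gtk' _].
- exact: subsetT.
- case: B => [_ /(_ bj nhj) nh _|//|k hj _ _ _]; last by rewrite hj in nhj.
  by have := nh _ (subsetP sub _ ki'); rewrite kh'.
case: B => [_ _ /(_ hj) le|k _ nhj|k _ ki lk gtk kmin].
- have : wt (jobs s' i :&: light k') <= wt (bigs s i).
    apply: wt_subset; apply/subsetP => k; rewrite !inE => /and3P[ki -> _].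
    have : k \in jobs s' i by rewrite inE.
    by move/(subsetP sub); rewrite inE => ->.
  by have := wt_subset lsub; move: le gtk'; lra.
- by rewrite hj in nhj.
apply/subsetP => l; rewrite !inE => /and3P[-> -> lk'k] /=.
(* Were [k'] lighter than [k], minimality of [k] would bound the old load up to [k'], hence also the
   smaller new one. *)
rewrite (le_trans lk'k) // leNgt; apply/negP => lt.
have := kmin k' (subsetP bsub _ k'i) lt.
have : wt (jobs s' i :&: light k') <= wt (jobs s i :&: light k').
  by apply/wt_subset/setSI.
by have := wt_subset lsub; move: gtk'; lra.
Qed.

(** The conditions only look at the locked jobs and the barred jobs on [i]; excluding [j] from the
    barred set is harmless because [j] is not on [i]. *)
Lemma blocks_local tr s s' j i K :
  s j != Some i -> s' j != Some i ->
  locked tr s' i = locked tr s i -> jobs s' i :&: K = jobs s i :&: K ->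
  blocks tr s j i K -> blocks tr s' j i K.
Proof.
move=> ji ji' lE jE B.
case: B jE => [nfit nh hle|k bj nhj ki kh|k hj ki lk gtk kmin] jE.
- move: jE; rewrite !setIT => jE.
  by apply: Blocks_all; rewrite ?/fits ?/bigs jE ?lE.
- apply: (@Blocks_huge _ _ _ _ k) => //.
  have : k \in jobs s' i :&: [set k | huge k] by rewrite jE !inE kh -in_jobs ki.
  by rewrite in_setI => /andP[].
have {}jE : jobs s' i :&: light k = jobs s i :&: light k.
  apply/setP => l; have [->|lj] := eqVneq l j.
    by rewrite !inE (negbTE ji) (negbTE ji').
  by have /setP/(_ l) := jE; rewrite ![l \in _ :&: _]inE !in_setD1 lj.
have kl (l : J) : l \in bigs s' i -> p l <= p k -> l \in bigs s i.
  move=> li llk; have : l \in jobs s' i :&: light k.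
    by move: li; rewrite !inE llk => /andP[-> ->].
  by rewrite jE !inE => /and3P[-> ->].
have ki' : k \in bigs s' i.
  have : k \in jobs s i :&: light k.
    by move: ki; rewrite !inE lexx => /andP[-> ->].
  by rewrite -jE !inE => /and3P[-> ->].
apply: Blocks_light; rewrite ?lE ?jE // => l li llk.
rewrite (_ : jobs s' i :&: light l = jobs s i :&: light l).
  by apply: kmin => //; apply: kl (ltW llk).
have E : light k :&: light l = light l.
  apply/setP => m; rewrite !inE; case: (big m) => //=.
  by case ml: (p m <= p l); rewrite ?andbF // (le_trans ml (ltW llk)).
by rewrite -E !setIA jE.
Qed.

(** * Moving a job *)

Definition reassign s j i : {ffun J -> option M} :=
  [ffun k => if k == j then Some i else s k].

Lemma jobs_reassign s j i i' :
  jobs (reassign s j i) i' = if i' == i then j |: jobs s i else jobs s i' :\ j.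
Proof.
apply/setP => k; case: eqP => [->|/eqP ni]; rewrite !inE ffunE.
  by case: (k == j); rewrite ?eqxx.
case: (k == j) => //=; apply/eqP => -[E]; by rewrite E eqxx in ni.
Qed.

Lemma feasible_reassign D s j i :
  feasible D s -> i \in gam j -> s j != Some i -> fits s j i ->
  feasible (j |: D) (reassign s j i).
Proof.
move=> [Ds sg sc] ij ji fit; split=> [k|k i'|i'].
- by rewrite !inE ffunE Ds; case: eqP.
- by rewrite ffunE; case: eqP => [-> [<-]//|_ /sg].
rewrite jobs_reassign; case: eqP => _.
  rewrite /wt big_setU1 ?inE //= addrC; exact: fit.
by apply: le_trans (sc i'); apply: wt_subset; apply: subD1set.
Qed.

Lemma locked_active tr s i j : j \in locked tr s i -> active tr s j.
Proof. by move=> jl; apply/or3P/Or32/existsP; exists i. Qed.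

Lemma keys_active tr s i j K :
  (i, K) \in keys tr -> s j = Some i -> j \in K -> active tr s j.
Proof.
move=> iK ji jK; apply/or3P/Or33/existsP; exists (i, K).
by rewrite iK ji eqxx jK.
Qed.

Lemma potential_frozen tr s j i : potential tr s j i -> i \notin frozen tr.
Proof.
by move=> [_ _ _ perm]; rewrite inE; apply/negP => /perm; rewrite inE.
Qed.

Lemma potential_locked tr s j i i' :
  potential tr s j i -> j \notin locked tr s i'.
Proof.
move=> pot; have nf := potential_frozen pot; case: pot => _ ij ji _.
apply/negP; rewrite !inE => /and3P[/eqP ji' _ /subsetP /(_ _ ij)].
rewrite in_setU1 (negbTE nf) orbF => /eqP E.
by rewrite E ji' eqxx in ji.
Qed.

Section Reassign.

Variables (D : {set J}) (s : {ffun J -> option M}) (j : J) (i : M).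
Hypothesis s_feas : feasible D s.
Hypothesis jD : j \in D.
Hypothesis ji : s j != Some i.
Local Notation s' := (reassign s j i).

Lemma active_reassign tr k : ~~ active tr s j -> active tr s k -> active tr s' k.
Proof.
move=> nj ak; have kj : k != j by apply/eqP => E; rewrite -E ak in nj.
have sk : s' k = s k by rewrite ffunE (negbTE kj).
move: ak; rewrite /active => /or3P[->//|/existsP[i' ki']|ak].
  apply/or3P/Or32/existsP; exists i'; move: ki'.
  by rewrite /locked !inE sk.
by rewrite sk ak !orbT.
Qed.

(** If [j] became locked on [i], the machine it came from would be frozen, so [j] would have been
    active. *)
Lemma locked_reassign tr i' :
  ~~ active tr s j -> i \notin frozen tr -> locked tr s' i' = locked tr s i'.
Proof.
case: s_feas => Ds sg _ nj nf; apply/setP => k.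
have [->|kj] := eqVneq k j; last by rewrite !inE ffunE (negbTE kj).
have -> : (j \in locked tr s i') = false.
  by apply/negP => /locked_active; rewrite (negbTE nj).
apply/negP; rewrite !inE ffunE eqxx => /and3P[/eqP[<-] _ sub].
move: jD; rewrite Ds; case E: (s j) => [m|//] _.
have := subsetP sub _ (sg _ _ E); rewrite in_setU1 => /orP[/eqP mi|].
  by move: ji; rewrite E mi eqxx.
by rewrite inE => mf; case/negP: nj; apply: keys_active mf E _; rewrite inE.
Qed.

Lemma jobs_barred_reassign tr i' K :
  ~~ active tr s j -> (forall K, (i, K) \in keys tr -> j \notin K) ->
  (i', K) \in keys tr -> jobs s' i' :&: K = jobs s i' :&: K.
Proof.
move=> nj perm iK; apply/setP => k.
have [->|kj] := eqVneq k j; last by rewrite !inE ffunE (negbTE kj).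
rewrite !in_setI; case jK: (j \in K); rewrite ?andbF // !andbT !inE ffunE eqxx.
have -> : (s j == Some i') = false.
  by apply/negP => /eqP E; case/negP: nj; apply: keys_active iK E jK.
by apply/negP => /eqP[E]; move: (perm K); rewrite E iK jK => /(_ isT).
Qed.

Lemma activeW b tr k : active tr s k -> active (b :: tr) s k.
Proof.
rewrite /active => /or3P[->//|/existsP[i' kl]|/existsP[e /and3P[ek se ke]]].
  apply/or3P/Or32/existsP; exists i'; move: kl; rewrite !inE.
  move=> /and3P[-> ->]/= /subset_trans; apply; apply: setUS.
  by apply/subsetP => m; rewrite !inE => ->; rewrite orbT.
by apply/or3P/Or33/existsP; exists e; rewrite inE ek se ke orbT.
Qed.

(** An inactive job is not barred where it leaves, and by assumption not where it enters. So barred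
    jobs stay in place, and with them all blockers and their ranks. *)
Lemma good_reassign tr :
  ~~ active tr s j -> (forall K, (i, K) \in keys tr -> j \notin K) ->
  good tr s -> good tr s'.
Proof.
elim: tr => [//|b tr IH] nj perm [gs [am im nm pm] [bl rk] nb df].
have nj' : ~~ active tr s j by apply: contra nj => /activeW.
have perm' K : (i, K) \in keys tr -> j \notin K.
  by move=> iK; apply: perm; rewrite inE iK orbT.
have nf : i \notin frozen tr by rewrite inE; apply/negP => /perm'; rewrite inE.
have bk : (target b, barred b) \in keys (b :: tr) by rewrite inE eqxx.
have jE := jobs_barred_reassign nj perm bk.
have mj : mover b != j by apply/eqP => E; rewrite -E am in nj'.
split=> //; first exact: IH.
- split=> //; first exact: active_reassign.
  by rewrite ffunE (negbTE mj).
split.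
  apply: blocks_local bl => //; first by rewrite ffunE (negbTE mj).
  exact: locked_reassign.
rewrite rk; apply: eq_card => k; rewrite !in_setU !in_setC.
by have /setP/(_ k) := jE; rewrite !in_setI; case: (k \in barred b); rewrite ?andbT.
Qed.

End Reassign.

(** * Progress on the oldest responsible blocker *)

Definition solved (D : {set J}) := exists s, feasible (j0 |: D) s.

(* Either [j0] can be inserted, or some blocker of the list can be improved
   without touching the older ones. *)
Definition backtrack (D : {set J}) tr :=
  solved D \/
  exists tr2 j i K n tr1 s,
    [/\ tr = tr2 ++ Blocker j i K n :: tr1, feasible D s, good tr1 s
      & (potential tr1 s j i /\ fits s j i) \/
        exists K' n', (n' < n)%N /\ good (Blocker j i K' n' :: tr1) s].

Lemma backtrack_cons b D tr s :
  good (b :: tr) s -> feasible D s ->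
  forall j i, potential (b :: tr) s j i -> fits s j i ->
  j \in D -> ~~ active tr s j -> active (b :: tr) s j ->
  exists s', [/\ feasible D s', good tr s'
      & (potential tr s' (mover b) (target b) /\ fits s' (mover b) (target b)) \/
        exists K' n', (n' < rank b)%N /\
          good (Blocker (mover b) (target b) K' n' :: tr) s'].
Proof.
move=> gb feas j i pot fit jD nj aj; exists (reassign s j i).
have [_ ij ji perm] := pot.
have perm' K : (i, K) \in keys tr -> j \notin K.
  by move=> iK; apply: perm; rewrite inE iK orbT.
have nf : i \notin frozen tr by rewrite inE; apply/negP => /perm'; rewrite inE.
have [gt [am im nm pm] [bl rk] nb df] := gb.
have feas' : feasible D (reassign s j i).
  by rewrite -(setUidPr (_ : [set j] \subset D)) ?sub1set //; apply: feasible_reassign.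
(* Since [b] is what makes [j] active and a job with a potential move is never locked, [j] is barred
   on the target of [b]. *)
have [sj jK] : s j = Some (target b) /\ j \in barred b.
  move: aj; rewrite /active => /or3P[E|/existsP[i' jl]|/existsP[[i' K]]].
  - by case/negP: nj; rewrite /active E.
  - by rewrite (negbTE (potential_locked i' pot)) in jl.
  rewrite inE => /and3P[/orP[/eqP[-> ->] /eqP->//|iK] /eqP jK jKK].
  by case/negP: nj; apply: keys_active iK jK jKK.
have mj : mover b != j by apply/eqP => E; rewrite -E am in nj.
have gt' : good tr (reassign s j i) by apply: good_reassign feas _ _ _ _ _ _.
have pot' : potential tr (reassign s j i) (mover b) (target b).
  split=> //; first exact: active_reassign.
  by rewrite ffunE (negbTE mj).
split=> //; case fit' : (fits (reassign s j i) (mover b) (target b)); [by left|right].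
have ti : target b != i by apply/eqP => E; rewrite -E sj eqxx in ji.
have sub : jobs (reassign s j i) (target b) = jobs s (target b) :\ j.
  by rewrite jobs_reassign (negbTE ti).
have lE : locked tr (reassign s j i) (target b) = locked tr s (target b).
  by apply: locked_reassign feas _ _ _ _ _ _.
have [K' bl'] : exists K', blocks tr (reassign s j i) (mover b) (target b) K'.
  apply: exists_blocks; rewrite ?fit' // lE => hm.
  case: bl => [_ _ /(_ hm)|k _|//]; last by rewrite hm.
  by have := wt_ge0 (bigs s (target b)); lra.
have KK' : barred b \subset K'.
  by apply: blocks_mono bl bl'; rewrite ?lE // sub subD1set.
exists K', #|~: K' :|: jobs (reassign s j i) (target b)|; split.
  rewrite rk sub; apply: proper_card; apply/properP; split.
    apply/subsetP => k; rewrite !inE => /orP[kK|/andP[_ ->]]; last by rewrite orbT.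
    by rewrite (contra (subsetP KK' k) kK).
  by exists j; rewrite !inE ?sj ?eqxx ?orbT // (subsetP KK' j jK).
split=> //; apply/negP => iK'; case/negP: nj.
by apply: keys_active iK' sj (subsetP KK' j jK).
Qed.

(** Newer blockers are discarded until the head is the oldest one that makes [j] active; [j0] is
    inserted at once. *)
Lemma backtrack_potential D tr s j i :
  feasible D s -> j0 \notin D -> good tr s ->
  potential tr s j i -> fits s j i -> backtrack D tr.
Proof.
move=> feas j0D g pot fit.
have [jj0|jj0] := eqVneq j j0.
  left; exists (reassign s j0 i); rewrite -jj0; case: pot => _ ij ji _.
  exact: feasible_reassign.
right; have [aj ij ji perm] := pot.
have jD : j \in D.
  case: feas => -> _ _; move: aj; rewrite /active (negbTE jj0) /=.
  case/orP => /existsP.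
    by case=> m; rewrite !inE => /and3P[/eqP->].
  by case=> k /and3P[_ /eqP->].
elim: tr g pot aj perm => [|b tr IH] g pot aj perm.
  exfalso; move: aj; rewrite /active (negbTE jj0) /=.
  case/orP => /existsP; last by case.
  by case=> m ml; rewrite (negbTE (potential_locked m pot)) in ml.
case aj': (active tr s j).
  have perm' K : (i, K) \in keys tr -> j \notin K.
    by move=> iK; apply: perm; rewrite inE iK orbT.
  have [||//|//|tr2 [j1 [i1 [K [n [tr1 [s' [-> H]]]]]]]] := IH.
  - by case: g.
  - by split.
  by exists (b :: tr2), j1, i1, K, n, tr1, s'; split=> //; case: H.
have [s' [f' g' H]] := backtrack_cons g feas pot fit jD (negbT aj') aj.
by case: b g pot aj perm H => m u K n *; exists [::], m, u, K, n, tr, s'; split.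
Qed.

(** * Truncated weights and frozen machines *)

Definition weight (X : {set J}) := \sum_(j in X) Num.min (p j) (5 / 6 * t).

Lemma trunc_ge0 j : 0 <= Num.min (p j) (5 / 6 * t).
Proof. by rewrite le_min p_ge0 /=; have := t_ge0; lra. Qed.

Lemma weight_subset (X Y : {set J}) : X \subset Y -> weight X <= weight Y.
Proof. exact: sum_subset trunc_ge0. Qed.

Lemma weight_wt (X : {set J}) :
  (forall k, k \in X -> ~~ huge k) -> weight X = wt X.
Proof.
move=> nh; apply: eq_bigr => k /nh; rewrite /huge -leNgt => ?.
by rewrite min_l.
Qed.

Lemma weight_huge (X : {set J}) k :
  k \in X -> huge k -> weight X = 5 / 6 * t + weight (X :\ k).
Proof.
by move=> kX /ltW kh; rewrite /weight (big_setD1 k kX) /= min_r.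
Qed.

Lemma weight_ge0 (X : {set J}) : 0 <= weight X.
Proof. by apply: sumr_ge0 => j _; apply: trunc_ge0. Qed.

(** Two huge jobs already weigh [5/3 t], and truncating a single one loses at most [t/6]. *)
Lemma weight_overloaded (X : {set J}) :
  4 / 3 * t < wt X -> 7 / 6 * t <= weight X.
Proof.
move=> gt; have t0 := t_ge0.
have [/existsP[k /andP[kX kh]]|nk] := boolP [exists k, (k \in X) && huge k];
    last first.
  rewrite weight_wt; first by lra.
  by move=> k kX; apply: contra nk => kh; apply/existsP; exists k; rewrite kX.
rewrite (weight_huge kX kh); set Y := X :\ k.
have [/existsP[l /andP[lY lh]]|nl] := boolP [exists l, (l \in Y) && huge l].
  by rewrite (weight_huge lY lh); have := weight_ge0 (Y :\ l); lra.
rewrite weight_wt; last first.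
  by move=> l lY; apply: contra nl => lh; apply/existsP; exists l; rewrite lY.
by move: gt; rewrite /wt (big_setD1 k kX) /=; have := p_le k; lra.
Qed.

(** The other two kinds of barred set omit [j] itself. *)
Lemma blocks_setT tr s j i : blocks tr s j i setT ->
  [/\ ~~ fits s j i,
      big j -> ~~ huge j -> forall k, k \in jobs s i -> ~~ huge k
    & huge j -> wt (locked tr s i) + wt (bigs s i) + p j <= cap].
Proof.
move E: setT => K B; case: B E => [//|k _ nhj _ _|k _ _ _ _ _] /setP/(_ j).
  by rewrite !inE (negbTE nhj).
by rewrite !inE eqxx.
Qed.

Lemma blocks_small tr s j i K : blocks tr s j i K -> ~~ big j -> K = setT.
Proof.
by case=> // [k ->//|k /huge_big ->//].
Qed.

Lemma frozen_cons b tr :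
  frozen (b :: tr) =
  if barred b == setT then target b |: frozen tr else frozen tr.
Proof.
apply/setP => i; rewrite inE in_cons xpair_eqE /= [setT == _]eq_sym.
case: (barred b == setT); rewrite ?andbT ?andbF ?in_setU1.
  by rewrite [i \in frozen tr]inE.
by rewrite [i \in frozen tr]inE.
Qed.

(* A machine frozen for a huge job may miss [t / 6] of the weight [t]; the
   machine frozen right after it for a small job makes up for the loss. *)
Lemma frozen_weight tr s : good tr s ->
  t *+ #|frozen tr| - (if deficient tr then 1 / 6 * t else 0)
    <= \sum_(i in frozen tr) weight (jobs s i).
Proof.
have t0 := t_ge0.
elim: tr => [_|b tr IH [/IH {}IH [_ _ _ _] [bl _] nb df]].
  by rewrite /= subr0 (_ : frozen [::] = set0) ?cards0 ?big_set0 //;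
    apply/setP => i; rewrite !inE.
rewrite frozen_cons /=; case: eqP => [bT|/eqP nbT]; last first.
  (* After a deficient blocker the mover is small and hence freezes its target. *)
  rewrite andbF; case: (deficient tr) IH df => IH df //.
  by rewrite (blocks_small bl (df isT)) eqxx in nbT.
have nf : target b \notin frozen tr by rewrite inE -bT.
rewrite cardsU1 nf big_setU1 //= mulrnDr mulr1n andbT.
rewrite bT in bl; have [] := blocks_setT bl; rewrite /fits -ltNge => nfit med hug.
have pm := p_le (mover b).
have [hm|nhm] := boolP (huge (mover b)).
  have nd : deficient tr = false by apply/negP => /df; rewrite (huge_big hm).
  rewrite nd in IH.
  suff : 5 / 6 * t <= weight (jobs s (target b)) by lra.
  have [/existsP[k /andP[kX kh]]|nk] :=
      boolP [exists k, (k \in jobs s (target b)) && huge k].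
    by rewrite (weight_huge kX kh); have := weight_ge0 (jobs s (target b) :\ k); lra.
  rewrite weight_wt; first by lra.
  by move=> k kX; apply: contra nk => kh; apply/existsP; exists k; rewrite kX.
(* A big mover that is not huge leaves a load above [11/6 t - 5/6 t = t], with no huge job to
   truncate. *)
have [bm|nbm] := boolP (big (mover b)).
  have nd : deficient tr = false by apply/negP => /df; rewrite bm.
  rewrite nd in IH.
  rewrite weight_wt; last exact: med.
  by move: nhm; rewrite /huge -leNgt; lra.
(* A small mover leaves a load above [11/6 t - t/2 = 4/3 t]; the surplus [t/6] repays a preceding
   deficit. *)
have : 7 / 6 * t <= weight (jobs s (target b)).
  by apply: weight_overloaded; move: nbm; rewrite /big -leNgt; lra.
by case: ifP IH => _; lra.
Qed.

Lemma good_key tr s i K : good tr s -> (i, K) \in keys tr ->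
  exists tr' j, s j != Some i /\ blocks tr' s j i K.
Proof.
elim: tr => [_ //|b tr IH] [gt [_ _ bt _] [bl _] _ _].
rewrite in_cons => /orP[/eqP[-> ->]|]; last exact: IH.
by exists tr, (mover b).
Qed.

Lemma small_barred tr s i K k : good tr s -> (i, K) \in keys tr ->
  k \in K -> ~~ big k -> i \in frozen tr.
Proof.
move=> g iK kK nb; have [tr' [j [_ bl]]] := good_key g iK.
case: bl iK kK => [_ _ _|l _ _ _ _|l _ _ _ _ _] iK kK; first by rewrite inE.
  by move: kK; rewrite inE => /huge_big; rewrite (negbTE nb).
by move: kK; rewrite !inE (negbTE nb) andbF.
Qed.

(** Weak duality stands in for the feasible LP solution. *)
Hypothesis dual : forall (y : M -> R) (z : J -> R),
  (forall j, 0 <= z j) ->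
  (forall i (C : {set J}), (forall j, j \in C -> i \in gam j) -> wt C <= t ->
     \sum_(j in C) z j <= y i) ->
  \sum_j z j <= \sum_i y i.

(** * A stuck search contradicts duality *)

Section Stuck.

Variables (D : {set J}) (tr : seq blocker) (s : {ffun J -> option M}).
Hypotheses (s_feas : feasible D s) (j0D : j0 \notin D) (s_good : good tr s).
Hypothesis nfit : forall j i, potential tr s j i -> ~~ fits s j i.
Hypothesis nblocker : forall b, ~ good (b :: tr) s.

Lemma s_j0 : s j0 = None.
Proof. by case: s_feas => /(_ j0); rewrite (negbTE j0D); case: (s j0). Qed.

(** Only [setT] bars a small job, so otherwise the move would be potential and, as it does not fit,
    would yield a new blocker. *)
Lemma stuck_small_frozen j i : active tr s j -> ~~ big j -> i \in gam j ->
  s j != Some i -> i \in frozen tr.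
Proof.
move=> aj nbj ij ji; apply: contraT => nf.
have pot : potential tr s j i.
  split=> // K iK; apply/negP => jK; case/negP: nf.
  exact: small_barred s_good iK jK nbj.
exfalso; apply: (@nblocker (Blocker j i setT #|~: setT :|: jobs s i|)).
split=> //=; last by move: nf; rewrite inE.
split=> //; apply: Blocks_all; first exact: nfit.
- by move=> bj; rewrite bj in nbj.
by move=> /huge_big bj; rewrite bj in nbj.
Qed.

(** The small jobs on the machine just frozen can only go to frozen machines, so they were locked
    before. Then locked and big jobs make up the whole load, which the blocker says leaves room for
    its huge mover. *)
Lemma stuck_not_deficient : ~~ deficient tr.
Proof.
apply/negP => df.
case: tr s_good stuck_small_frozen df => [//|b tr'].
move=> [_ _ [bl _] _ _] sf /= /andP[hm /eqP bT].
rewrite bT in bl; have [nf _ /(_ hm) le] := blocks_setT bl.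
case/negP: nf; apply: le_trans le; rewrite lerD2r.
have sub : jobs s (target b) \subset
    locked tr' s (target b) :|: bigs s (target b).
  apply/subsetP => k ki; have ki' := ki; move: ki'; rewrite in_jobs => ki'.
  rewrite in_setU /bigs /locked !in_set ki' /=.
  have [bk|nbk] := boolP (big k); first by rewrite orbT.
  rewrite orbF /=; apply/subsetP => i ik.
  have [E|ti] := eqVneq i (target b); first by rewrite E in_setU1 eqxx.
  have : i \in frozen (b :: tr').
    apply: (sf k i) => //; last first.
      by move: ki; rewrite in_jobs => /eqP ->; apply/eqP => -[E]; rewrite E eqxx in ti.
    apply: (@keys_active _ _ (target b) _ setT); rewrite ?inE ?bT ?eqxx //.
    by apply/eqP; rewrite -in_jobs.
  by rewrite frozen_cons bT eqxx.
apply: le_trans (wt_subset sub) _.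
rewrite /wt (big_setID (bigs s (target b))) /= addrC lerD //.
  apply: wt_subset; apply/subsetP => k; rewrite !in_setD in_setU.
  by case: (k \in bigs _ _); rewrite //= orbF.
by apply: wt_subset; apply: subsetIr.
Qed.

Lemma stuck_key j i K :
  potential tr s j i -> blocks tr s j i K -> (i, K) \in keys tr.
Proof.
move=> pot bl; apply/negPn/negP => iK.
apply: (@nblocker (Blocker j i K #|~: K :|: jobs s i|)); split=> //=.
by rewrite (negbTE stuck_not_deficient).
Qed.

(** Dual feasibility: at most one active job [j] of [C] is off [i]. It is big, so the others are
    small and locked on [i]; active big jobs on [i], or its total active load, must pay for [j]. *)
Lemma stuck_config i (C : {set J}) : i \notin frozen tr ->
  (forall j, j \in C -> i \in gam j) -> wt C <= t ->
  weight [set j in C | active tr s j] <= weight [set j in jobs s i | active tr s j].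
Proof.
move=> nf Ci Ct; set CA := [set _ in C | _]; set A := [set _ in jobs s i | _].
have t0 := t_ge0.
have [sub|/subsetPn[j jC jA]] := boolP (CA \subset A); first exact: weight_subset.
have [{}jC aj] : j \in C /\ active tr s j by move: jC; rewrite inE => /andP[].
have ji : s j != Some i by move: jA; rewrite !inE aj andbT.
have bj : big j.
  by apply/negPn/negP => nbj; case/negP: nf; apply: stuck_small_frozen aj nbj (Ci _ jC) ji.
pose L := CA :\ j.
have jCA : j \in CA by rewrite inE jC.
have pL : p j + wt L <= t.
  apply: le_trans Ct; rewrite (_ : p j + wt L = wt CA).
    by apply: wt_subset; apply/subsetP => k; rewrite inE => /andP[].
  by rewrite [RHS](big_setD1 j jCA).
have Lsmall k : k \in L -> ~~ big k.
  move=> kL; apply/negP => bk; have : p k <= wt L.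
    by rewrite /wt (big_setD1 k kL) lerDl wt_ge0.
  by move: bj bk pL; rewrite /big; lra.
have lockA : locked tr s i \subset A.
  apply/subsetP => k kl; rewrite !inE (locked_active kl) andbT.
  by move: kl; rewrite !inE => /andP[].
have Llock : L \subset locked tr s i.
  apply/subsetP => k kL; have nbk := Lsmall _ kL.
  have [kC ak] : k \in C /\ active tr s k by move: kL; rewrite !inE => /and3P[].
  have ki : s k = Some i.
    apply/eqP/negPn/negP => ki; case/negP: nf.
    exact: stuck_small_frozen ak nbk (Ci _ kC) ki.
  move: ak; rewrite /active => /or3P[/eqP E|/existsP[m km]|/existsP[[m K]]].
  - by move: ki; rewrite E s_j0.
  - suff <- : m = i by [].
    by move: km; rewrite !inE ki => /andP[/eqP[->]].
  move=> /and3P[iK /eqP km kK]; move: km; rewrite ki => -[E].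
  by rewrite -E in iK; rewrite (small_barred s_good iK kK nbk) in nf.
have wL : weight L = wt L.
  by apply: weight_wt => k /Lsmall; apply: contra; apply: huge_big.
have -> : weight CA = Num.min (p j) (5 / 6 * t) + wt L.
  by rewrite /weight (big_setD1 j jCA) -wL.
have wj1 : Num.min (p j) (5 / 6 * t) <= 5 / 6 * t by rewrite ge_min lexx orbT.
have caseA k : k \in A -> big k ->
    Num.min (p j) (5 / 6 * t) <= Num.min (p k) (5 / 6 * t) ->
    Num.min (p j) (5 / 6 * t) + wt L <= weight A.
  move=> kA bk le; rewrite /weight (big_setD1 k kA) lerD //= -wL.
  apply: weight_subset; apply/subsetP => l lL; rewrite in_setD1.
  rewrite (subsetP lockA _ (subsetP Llock _ lL)) andbT.
  by apply: contraTneq bk => <-; apply: Lsmall.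
have [/existsP[k /andP[kA kh]]|nh] := boolP [exists k, (k \in A) && huge k].
  by apply: caseA kA (huge_big kh) _; rewrite [leRHS]min_r ?(ltW kh).
have {}nh k : k \in A -> ~~ huge k.
  by move=> kA; apply: contra nh => kh; apply/existsP; exists k; rewrite kA.
have keyA K k : (i, K) \in keys tr -> k \in jobs s i -> k \in K -> k \in A.
  move=> iK ki kK; rewrite inE ki; apply: keys_active iK _ kK.
  by apply/eqP; rewrite -in_jobs.
have wA : weight A = wt A by apply: weight_wt.
(* If [j] is barred from [i], the job [k] defining the barred set is active on [i] and at least as
   heavy. *)
have [perm|] := boolP [forall K, ((i, K) \in keys tr) ==> (j \notin K)]; last first.
  rewrite negb_forall => /existsP[K]; rewrite negb_imply negbK => /andP[iK jK].
  have [tr' [l [li bl]]] := good_key s_good iK.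
  case: bl iK jK => [_ _ _|k _ _ ki kh|k _ ki _ _ _] iK jK.
  - by rewrite inE iK in nf.
  - have kA : k \in A by apply: keyA iK ki _; rewrite inE.
    by have := nh _ kA; rewrite kh.
  move: ki; rewrite inE => /andP[ki bk].
  have ki' : s k == Some i by rewrite -in_jobs.
  apply: (caseA k) => //.
    apply: keyA iK ki _; rewrite in_setD1 [k \in light k]inE bk lexx !andbT.
    by apply: contraNneq li => <-.
  by apply: le_min2 => //; move: jK; rewrite !inE => /and3P[].
have pot : potential tr s j i.
  split=> // [|K iK]; first exact: Ci.
  by have /forallP/(_ K) := perm; rewrite iK.
have nft := nfit pot.
(* Since [p j + wt L <= t], [cap - p j] is at least [5/6 t + wt L]. *)
have hugeA : cap - p j < wt A -> huge j ->
    Num.min (p j) (5 / 6 * t) + wt L <= weight A.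
  by move=> gt hj; rewrite wA; lra.
have [hj|nhj] := boolP (huge j); last first.
  have [|K bl] := @exists_blocks tr s j i nft; first by move=> h; rewrite h in nhj.
  have iK := stuck_key pot bl.
  case: bl iK => [_ _ _|k _ _ ki kh|k hj _ _ _ _] iK.
  - by rewrite inE iK in nf.
  - have kA : k \in A by apply: keyA iK ki _; rewrite inE.
    by have := nh _ kA; rewrite kh.
  by rewrite hj in nhj.
have [le|gt] := lerP (wt (locked tr s i) + p j) cap; last first.
  by apply: hugeA => //; have := wt_subset lockA; lra.
have [//|K bl] := @exists_blocks tr s j i nft.
have iK := stuck_key pot bl.
case: bl iK => [_ _ _|k _ nhj _ _|k _ ki _ gtk _] iK.
- by rewrite inE iK in nf.
- by rewrite hj in nhj.
apply: hugeA => //; suff : wt (locked tr s i) + wt (jobs s i :&: light k) <= wt A.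
  by lra.
have jkA : jobs s i :&: light k \subset A.
  apply/subsetP => l; rewrite in_setI => /andP[li lk].
  apply: keyA iK (li) _; rewrite in_setD1 lk andbT.
  by apply: contraNneq ji => <-; rewrite -in_jobs.
rewrite /wt [leRHS](big_setID (jobs s i :&: light k)) /= (setIidPr jkA).
rewrite [leRHS]addrC lerD //.
apply: wt_subset; apply/subsetP => l ll; rewrite in_setD (subsetP lockA _ ll) andbT.
by apply/negP; move: ll; rewrite !inE => /and3P[_ /negbTE -> _]; rewrite andbF.
Qed.

Lemma stuck_absurd : 0 < p j0 -> False.
Proof.
move=> pj0; have t0 := t_ge0.
pose z j := if active tr s j then Num.min (p j) (5 / 6 * t) else 0.
pose W i := \sum_(j in jobs s i) z j.
pose y i := if i \in frozen tr then t else W i.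
have z0 j : 0 <= z j by rewrite /z; case: ifP => // _; apply: trunc_ge0.
have zE (X : {set J}) : \sum_(j in X) z j = weight [set j in X | active tr s j].
  by rewrite /weight -big_mkcondr; apply: eq_bigl => j; rewrite inE.
have : \sum_j z j <= \sum_i y i.
  apply: dual => // i C Ci Ct; rewrite /y; case: ifPn => [_|nf].
    apply: le_trans Ct; apply: ler_sum => j _; rewrite /z.
    by case: ifP => _ //; rewrite ge_min lexx.
  by rewrite /W !zE; apply: stuck_config.
rewrite leNgt => /negP; apply.
have -> : \sum_i y i = t *+ #|frozen tr| + \sum_(i | i \notin frozen tr) W i.
  rewrite (bigID (mem (frozen tr))) /= -sumr_const; congr (_ + _).
    by apply: eq_bigr => i fi; rewrite /y fi.
  by apply: eq_bigr => i fi; rewrite /y (negbTE fi).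
have FW : t *+ #|frozen tr| <= \sum_(i in frozen tr) W i.
  have := frozen_weight s_good; rewrite (negbTE stuck_not_deficient) subr0.
  move=> /le_trans; apply; apply: ler_sum => i fi; rewrite /W zE.
  apply: weight_subset; apply/subsetP => j ji; rewrite inE ji.
  apply: (@keys_active _ _ i _ setT); rewrite ?inE //.
  - by move: fi; rewrite inE.
  by apply/eqP; rewrite -in_jobs.
apply: le_lt_trans (lerD FW (lexx _)) _.
rewrite -[ltLHS](bigID (mem (frozen tr)) xpredT W) /=.
rewrite /W (exchange_big_dep xpredT) //=.
rewrite [ltRHS](bigD1 j0) // [ltLHS](bigD1 j0) //=.
(* Strictness comes from [j0], which has positive value but lies on no machine. *)
apply: ltr_leD.
  rewrite big_pred0 => [|i]; last by rewrite in_jobs s_j0.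
  rewrite /z /active eqxx /= lt_min pj0 /=.
  by have := p_le j0; lra.
apply: ler_sum => j _; case E: (s j) => [m|].
  by rewrite (big_pred1 m) // => i; rewrite in_jobs E eq_sym.
by rewrite big_pred0 // => i; rewrite in_jobs E.
Qed.

End Stuck.

(** * Termination of the search *)

Lemma extend (D : {set J}) tr s :
  feasible D s -> j0 \notin D -> 0 < p j0 -> good tr s ->
  (exists j i, potential tr s j i /\ fits s j i) \/
  (exists b, good (b :: tr) s).
Proof.
move=> feas j0D pj0 g; apply: boolp.contrapT => H.
apply: (stuck_absurd feas j0D g) pj0 => [j i pot|b gb].
  by apply/negP => fit; apply: H; left; exists j, i.
by apply: H; right; exists b.
Qed.

(** The keys are distinct, which bounds the length of the list: the outer induction is on the room
    left. The inner one is on the rank of the blocker just added, which drops whenever the progress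
    concerns that blocker. *)
Lemma backtrackP (D : {set J}) : j0 \notin D -> 0 < p j0 -> forall n tr s,
  (#|{: M * {set J}}| < n + size tr)%N ->
  feasible D s -> good tr s -> backtrack D tr.
Proof.
move=> j0D pj0; elim=> [|n IH] tr s.
  move=> lt _ g; suff : uniq (keys tr).
    move=> /card_uniqP E; have := max_card (mem (keys tr)).
    by rewrite E size_map leqNgt lt.
  by elim: tr g {lt} => //= b tr IH [/IH -> _ _ ->].
move=> lt feas g; have [[j [i [pot fit]]]|] := extend feas j0D pj0 g.
  exact: backtrack_potential pot fit.
case=> b gb; move: {2}(rank b).+1 (ltnSn (rank b)) => m.
elim: m b s feas g gb => [//|m IHm] b s feas g gb; rewrite ltnS => bm.
have lt' : (#|{: M * {set J}}| < n + size (b :: tr))%N by rewrite /= addnS.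
have [//|[tr2 [j [i [K [r [tr1 [s' [E f' g' H]]]]]]]]] := IH _ _ lt' feas gb.
  by left.
case: tr2 E => [|b2 tr2] /= E; last first.
  by case: E => _ ->; right; exists tr2, j, i, K, r, tr1, s'; split.
case: E => Eb Etr; rewrite -Etr in g' H; case: H => [[pot fit]|[K' [r' [lr gb']]]].
  exact: backtrack_potential pot fit.
apply: (IHm _ s' f' g' gb') => /=.
by apply: leq_trans lr _; move: bm; rewrite Eb.
Qed.

(** The empty list has no blocker to improve, so only insertion remains. *)
Lemma extend_schedule D s :
  feasible D s -> j0 \notin D -> 0 < p j0 -> exists s', feasible (j0 |: D) s'.
Proof.
move=> feas j0D pj0.
have [||[tr2 [j [i [K [n [tr1 [s' [E]]]]]]]]] :=
    @backtrackP D j0D pj0 #|{: M * {set J}}|.+1 [::] s _ feas I => //.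
  by rewrite addn0.
by case: tr2 E.
Qed.

End LocalSearch.

(** * Inserting all jobs *)

Section CompleteSchedule.

Variables (R : realFieldType) (J M : finType) (p : J -> R).
Variables (gam : J -> {set M}) (t : R).
Hypothesis p_ge0 : forall j, 0 <= p j.
Hypothesis p_le : forall j, p j <= t.
Hypothesis t_nneg : 0 <= t.
Hypothesis gam_neq0 : forall j, gam j != set0.
Hypothesis dual : forall (y : M -> R) (z : J -> R),
  (forall j, 0 <= z j) ->
  (forall i (C : {set J}), (forall j, j \in C -> i \in gam j) -> wt p C <= t ->
     \sum_(j in C) z j <= y i) ->
  \sum_j z j <= \sum_i y i.

Lemma extend_feasible (D : {set J}) s j : feasible p gam t D s -> j \notin D ->
  exists s', feasible p gam t (j |: D) s'.
Proof.
move=> feas jD; have [pj|pj] := ltP 0 (p j).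
  exact: (extend_schedule p_ge0 p_le dual feas jD pj).
have /set0Pn[i ij] := gam_neq0 j.
have sj : s j = None by case: feas => /(_ j); rewrite (negbTE jD); case: (s j).
exists (reassign s j i); apply: feasible_reassign => //; first by rewrite sj.
by case: feas => _ _ /(_ i); rewrite /fits; move: pj; lra.
Qed.

Lemma exists_schedule : exists f : {ffun J -> M},
  (forall j, f j \in gam j) /\ (forall i, \sum_(j | f j == i) p j <= 11 / 6 * t).
Proof.
have [s [sT sg sc]] : exists s, feasible p gam t setT s.
  suff H n : forall D s, #|~: D| = n -> feasible p gam t D s ->
      exists s', feasible p gam t setT s'.
    apply: (H _ set0 [ffun=> None] erefl); split=> [j|j i|i].
    - by rewrite inE ffunE.
    - by rewrite ffunE.
    rewrite /wt big1 => [|j]; last by rewrite inE ffunE.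
    by move: t_nneg; lra.
  elim: n => [|n IH] D s Dn feas.
    exists s; move/eqP: Dn; rewrite cards_eq0 => /eqP Dn.
    by rewrite -(setCK setT) setCT -Dn setCK.
  have /set0Pn[j] : ~: D != set0 by rewrite -card_gt0 Dn.
  rewrite inE => jD; have [s' feas'] := extend_feasible feas jD.
  apply: IH feas'; apply/eqP; rewrite -eqSS -Dn (cardsD1 j (~: D)) inE jD.
  by rewrite setCU setIC -setDE.
have /fin_all_exists[f fs] j : exists i, s j = Some i.
  by have := sT j; rewrite inE; case: (s j) => // i _; exists i.
exists [ffun j => f j]; split=> [j|i]; first by rewrite ffunE; apply: sg.
apply: le_trans (sc i); rewrite le_eqVlt; apply/orP; left; apply/eqP.
by apply: eq_bigl => j; rewrite inE ffunE fs.
Qed.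

End CompleteSchedule.

From mathcomp Require Import all_classical all_reals.

(** * Weak duality for the configuration-LP *)

Section ConfigurationLP.

Variables (R : realType) (I : ra_instance R) (t : R).
Hypothesis feas : config_LP_feasible I t.

Lemma config_LP_weak_duality (y : machine I -> R) (z : job I -> R) :
  0 <= t -> (forall j, 0 <= z j) ->
  (forall i (C : {set job I}), (forall j, j \in C -> i \in allowed j) ->
     wt (@ptime R I) C <= t -> \sum_(j in C) z j <= y i) ->
  \sum_j z j <= \sum_i y i.
Proof.
case: feas => x [x0 x1 x2] t0 z0 zy.
(* From the empty configuration; needed because the LP only gives total at most 1 on each
   machine. *)
have y0 i : 0 <= y i.
  have := zy i finset.set0; rewrite /wt !big_set0; apply => // j.
  by rewrite finset.in_set0.
apply: (@le_trans _ _ (\sum_j \sum_i \sum_(C in configs t i | j \in C) z j * x i C)).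
  apply: ler_sum => j _.
  have -> : \sum_i \sum_(C in configs t i | j \in C) z j * x i C =
      z j * \sum_i \sum_(C in configs t i | j \in C) x i C.
    by rewrite mulr_sumr; apply: eq_bigr => i _; rewrite mulr_sumr.
  by rewrite ler_peMr.
rewrite exchange_big /=; apply: ler_sum => i _.
rewrite (exchange_big_dep (fun C => C \in configs t i)) /=; last by move=> j C _ /andP[].
apply: (@le_trans _ _ (\sum_(C in configs t i) y i * x i C)).
  apply: ler_sum => C Ci; rewrite -mulr_suml.
  rewrite (eq_bigl (fun j => j \in C)); last by move=> j; rewrite Ci.
  apply: ler_wpM2r; first exact: x0.
  move: (Ci); rewrite in_configs => /andP[/forall_inP Ca Ct].
  exact: zy.
by rewrite -mulr_sumr ler_piMr.
Qed.

(** A longer job would lie in no configuration and could not be covered. *)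
Lemma config_LP_ptime_le (j : job I) : ptime j <= t.
Proof.
case: feas => x [_ _ /(_ j)]; rewrite leNgt => x2; rewrite leNgt.
apply: contra x2 => gt; rewrite big1 ?ltr01 // => i _; rewrite big1 // => C.
rewrite in_configs => /andP[/andP[_ Ct] jC].
suff : ptime j <= t by rewrite leNgt gt.
apply: le_trans Ct; rewrite (bigD1 j) //= lerDl.
by apply: sumr_ge0 => k _; apply: ptime_ge0.
Qed.

End ConfigurationLP.

Theorem theorem1 (R : realType) (I : ra_instance R) (OPT OPTstar : R) :
  is_OPT I OPT -> is_OPTstar I OPTstar -> OPT <= (2 - 1 / 6) * OPTstar.
Proof.
move=> [_ OPTmin] [[t0 feas] _].
have [f [fa fl]] := exists_schedule (@ptime_ge0 R I) (config_LP_ptime_le feas) t0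
  (@allowed_neq0 R I) (fun y z => config_LP_weak_duality feas t0).
have fs : schedule f by apply/forallP.
have : (OPT%:E <= makespan f)%E by apply: OPTmin; exists f.
rewrite makespan_schedule // lee_fin => /le_trans; apply.
rewrite (_ : 2 - 1 / 6 = 11 / 6); last by lra.
by apply/bigmax_leP; split=> //; apply: mulr_ge0 => //; lra.
Qed.
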